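(* Let $R=\bigoplus_{\alpha\in\Gamma}R_\alpha$ be a graded integral domain and $\star:\mathbf{HF}(R)\to\mathbf{HF}(R)$ be a homogeneous star operation on $R$. Then $$h\text{-}\mathrm{Max}^{\star_f}(R)=\{M\in\mathrm{Max}^{(\mathfrak{e}(\star_f))_f}(R)\mid M\cap H\neq\emptyset\}.$$
   Context: $\Gamma$ is a nonzero torsionless commutative cancellative monoid (torsionless means its quotient group $\langle\Gamma\rangle$ is torsion-free), $R=\bigoplus_{\alpha\in\Gamma}R_\alpha$ is an integral domain graded by $\Gamma$ with quotient field $K$, $H$ is the set of nonzero homogeneous elements of $R$, and $R_H$ is the localization, a $\langle\Gamma\rangle$-graded domain. $\mathbf{F}(R)$ is the set of nonzero fractional ideals of $R$ (nonzero $R$-submodules $A\subseteq K$ with $rA\subseteq R$ for some $0\ne r\in R$), and $(R:A)=\{x\in K\mid xA\subseteq R\}$. An ideal $I$ of $R$ is homogeneous if $I=\bigoplus_\alpha (I\cap R_\alpha)$; a fractional ideal $A$ is homogeneous if $sA$ is a homogeneous ideal of $R$ for some $s\in H$. $\mathbf{HF}(R)$ is the set of nonzero homogeneous fractional ideals. For $f\in R_H$, $\mathbf{C}(f)$ is the fractional ideal generated by the homogeneous components of $f$; for a fractional ideal $I\subseteq R_H$, $\mathbf{C}(I)=\sum_{f\in I}\mathbf{C}(f)$. A (classical) star operation on $R$ is a map $\star:\mathbf{F}(R)\to\mathbf{F}(R)$ such that for all $0\neq x\in K$ and $A,B\in\mathbf{F}(R)$: $(x)^\star=(x)$ and $(xA)^\star=xA^\star$;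 $A\subseteq A^\star$, and $A\subseteq B$ implies $A^\star\subseteq B^\star$; $(A^\star)^\star=A^\star$. A homogeneous star operation is a map $\mathbf{HF}(R)\to\mathbf{HF}(R)$ satisfying the same conditions for all nonzero homogeneous $x\in R_H$ and $A,B\in\mathbf{HF}(R)$. For a classical star operation $\star$, $A^{\star_f}=\bigcup\{B^\star\mid B\in\mathbf{F}(R)$ finitely generated, $B\subseteq A\}$. For a homogeneous star operation $\star$ and $A\in\mathbf{HF}(R)$, $A^{\star_f}=\bigcup\{B^\star\mid B\in\mathbf{HF}(R)$ finitely generated, $B\subseteq A\}$. These are again classical, resp. homogeneous, star operations. For a homogeneous star operation $\star$, $\mathfrak{e}(\star)$ is the classical star operation $A^{\mathfrak{e}(\star)}=\bigcap\{z^{-1}(\mathbf{C}(zA))^\star\mid 0\neq z\in(R:A)\}$, $A\in\mathbf{F}(R)$. For a classical (resp. homogeneous) star operation $*$, a nonzero ideal (resp. nonzero homogeneous ideal) $I$ of $R$ is a $*$-ideal if $I^*=I$. $\mathrm{Max}^{*}(R)$ (resp. $h\text{-}\mathrm{Max}^{*}(R)$) is the set of ideals maximal among proper $*$-ideals (resp. among proper homogeneous $*$-ideals) of $R$. *)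

(* Defs.v *)
From HB Require Import structures.
From mathcomp Require Import all_boot all_order all_algebra.
From mathcomp Require Import generic_quotient.
From mathcomp Require Import boolp classical_sets functions cardinality fsbigop.

Set Implicit Arguments.
Unset Strict Implicit.
Unset Printing Implicit Defensive.

Import GRing.Theory.

Local Open Scope ring_scope.
Local Open Scope classical_set_scope.
Local Open Scope quotient_scope.

Notation "x %:F" := (@FracField.tofrac _ x) : ring_scope.

(** ** The quotient group of a commutative monoid *)

Definition cancellative (M : nmodType) : Prop := right_injective (@GRing.add M).

(* (a, b) stands for a - b; the summand k makes this an equivalence relation
   for every commutative monoid, and can be dropped for cancellative ones. *)
Definition eqdiff (M : nmodType) (p q : M * M) : bool :=
  `[< exists k, p.1 + q.2 + k = q.1 + p.2 + k >].

Lemma eqdiff_refl (M : nmodType) : reflexive (@eqdiff M).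
Proof. by move=> p; apply/asboolP; exists 0. Qed.

Lemma eqdiff_sym (M : nmodType) : symmetric (@eqdiff M).
Proof. by move=> p q; apply/asboolP/asboolP => -[k pq]; exists k. Qed.

Lemma eqdiff_trans (M : nmodType) : transitive (@eqdiff M).
Proof.
move=> q p r /asboolP[k pq] /asboolP[l qr]; apply/asboolP.
exists (q.1 + q.2 + k + l).
have -> : p.1 + r.2 + (q.1 + q.2 + k + l)
        = (p.1 + q.2 + k) + (q.1 + r.2 + l).
  by rewrite (AC (2*4) ((1*4*5)*(3*2*6))).
rewrite pq qr.
by rewrite (AC (3*3) ((4*2)*(1*5*3*6))).
Qed.

Canonical eqdiff_equiv (M : nmodType) :=
  EquivRel (@eqdiff M) (@eqdiff_refl M) (@eqdiff_sym M) (@eqdiff_trans M).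

Definition quotient_group (M : nmodType) : Type := {eq_quot (@eqdiff M)}.

HB.instance Definition _ (M : nmodType) := Choice.on (quotient_group M).
HB.instance Definition _ (M : nmodType) :=
  EqQuotient.on (quotient_group M).

Definition qdiff (M : nmodType) (a b : M) : quotient_group M :=
  \pi_(quotient_group M) (a, b).

Lemma qdiffP (M : nmodType) (a b c d : M) :
  qdiff a b = qdiff c d <-> exists k, a + d + k = c + b + k.
Proof.
split=> [/eqP|h]; last apply/eqP; rewrite /qdiff eqmodE.
  by move/asboolP.
by apply/asboolP.
Qed.

Lemma qdiff_repr (M : nmodType) (x : quotient_group M) :
  x = qdiff (repr x).1 (repr x).2.
Proof. by rewrite /qdiff -surjective_pairing reprK. Qed.

Definition qg_zero (M : nmodType) : quotient_group M := qdiff 0 0.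

Definition qg_opp (M : nmodType) (x : quotient_group M) : quotient_group M :=
  qdiff (repr x).2 (repr x).1.

Definition qg_add (M : nmodType) (x y : quotient_group M) : quotient_group M :=
  qdiff ((repr x).1 + (repr y).1) ((repr x).2 + (repr y).2).

Lemma qg_oppE (M : nmodType) (a b : M) : qg_opp (qdiff a b) = qdiff b a.
Proof.
have /qdiffP[k e] := qdiff_repr (qdiff a b); apply/qdiffP; exists k.
by rewrite [b + _]addrC -e [_ + a]addrC.
Qed.

Lemma qg_addE (M : nmodType) (a b c d : M) :
  qg_add (qdiff a b) (qdiff c d) = qdiff (a + c) (b + d).
Proof.
have /qdiffP[k e] := qdiff_repr (qdiff a b).
have /qdiffP[l f] := qdiff_repr (qdiff c d).
apply/esym/qdiffP; exists (k + l).
set x := repr _ in e *; set y := repr _ in f *.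
have -> : a + c + (x.2 + y.2) + (k + l) = (a + x.2 + k) + (c + y.2 + l).
  by rewrite (AC (2*2*2) ((1*3*5)*(2*4*6))).
by rewrite e f (AC (3*3) ((1*4)*(2*5)*(3*6))).
Qed.

Lemma qg_addA (M : nmodType) : associative (@qg_add M).
Proof.
move=> x y z; rewrite (qdiff_repr x) (qdiff_repr y) (qdiff_repr z).
by rewrite !qg_addE !addrA.
Qed.

Lemma qg_addC (M : nmodType) : commutative (@qg_add M).
Proof.
move=> x y; rewrite (qdiff_repr x) (qdiff_repr y) !qg_addE.
by congr qdiff; rewrite addrC.
Qed.

Lemma qg_add0 (M : nmodType) : left_id (@qg_zero M) (@qg_add M).
Proof. by move=> x; rewrite (qdiff_repr x) qg_addE !add0r. Qed.

Lemma qg_addN (M : nmodType) :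
  left_inverse (@qg_zero M) (@qg_opp M) (@qg_add M).
Proof.
move=> x; rewrite (qdiff_repr x) qg_oppE qg_addE.
by apply/qdiffP; exists 0; rewrite !addr0 add0r addrC.
Qed.

HB.instance Definition _ (M : nmodType) :=
  GRing.isZmodule.Build (quotient_group M)
    (@qg_addA M) (@qg_addC M) (@qg_add0 M) (@qg_addN M).

Definition torsion_free (V : zmodType) : Prop :=
  forall (x : V) (n : nat), (0 < n)%N -> x *+ n = 0 -> x = 0.

Definition torsionless (M : nmodType) : Prop :=
  torsion_free (quotient_group M).

(** ** Gradings *)

Definition additive_subgroup (V : zmodType) (D : set V) : Prop :=
  D 0 /\ forall x y, D x -> D y -> D (x - y).

Definition decomposition (I : choiceType) (V : zmodType) (D : I -> set V)
    (x : V) (c : I -> V) : Prop :=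
  [/\ forall i, D i (c i), finite_set [set i | c i != 0]
    & x = \sum_(i \in [set: I]) c i].

Definition internal_direct_sum (I : choiceType) (V : zmodType)
    (S : set V) (D : I -> set V) : Prop :=
  (forall i, D i `<=` S) /\
  forall x, S x -> exists! c, decomposition D x c.

(* 1 \in gr 0 is automatic in a domain graded by a cancellative monoid. *)
Definition is_grading (M : nmodType) (R : idomainType) (gr : M -> set R) : Prop :=
  [/\ forall a, additive_subgroup (gr a),
      forall a b x y, gr a x -> gr b y -> gr (a + b) (x * y)
    & internal_direct_sum [set: R] gr].

(** ** Fractional ideals

    R is identified with its image in its field of fractions; ideals and
    fractional ideals of R are subsets of {fraction R}. *)

Definition base_ring (R : idomainType) : set {fraction R} :=
  range (fun r : R => r%:F).

Definition submodule (R : idomainType) (A : set {fraction R}) : Prop :=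
  [/\ A 0, forall x y, A x -> A y -> A (x + y)
    & forall (r : R) x, A x -> A (r%:F * x)].

Definition span (R : idomainType) (S : set {fraction R}) : set {fraction R} :=
  smallest (@submodule R) S.

Definition fin_gen (R : idomainType) (A : set {fraction R}) : Prop :=
  exists2 S : set {fraction R}, finite_set S & A = span S.

Definition scale (R : idomainType) (x : {fraction R}) (A : set {fraction R}) :
  set {fraction R} := [set x * a | a in A].

Definition principal (R : idomainType) (x : {fraction R}) :
  set {fraction R} := [set r%:F * x | r in [set: R]].

Definition is_ideal (R : idomainType) (A : set {fraction R}) : Prop :=
  submodule A /\ A `<=` @base_ring R.

(* The set F(R) *)
Definition frac_ideals (R : idomainType) : set (set {fraction R}) :=
  [set A | [/\ submodule A, A != [set 0]
             & exists2 r : R, r != 0 & scale r%:F A `<=` @base_ring R]].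

(* (R : A) *)
Definition colon (R : idomainType) (A : set {fraction R}) : set {fraction R} :=
  [set x | scale x A `<=` @base_ring R].

(** ** Homogeneous elements and homogeneous fractional ideals *)

Definition grF (M : nmodType) (R : idomainType) (gr : M -> set R) (a : M) :
  set {fraction R} := [set r%:F | r in gr a].

(* The set H *)
Definition hom_elts (M : nmodType) (R : idomainType) (gr : M -> set R) :
  set {fraction R} := [set x | x != 0 /\ exists a, grF gr a x].

(* The component of degree g of the localization R_H of R at hom_elts gr. The
   value 0 is added explicitly, since no a, b with gr b <> 0 need satisfy
   a - b = g. *)
Definition hom_loc_gr (M : nmodType) (R : idomainType) (gr : M -> set R)
    (g : quotient_group M) : set {fraction R} :=
  [set z | z = 0 \/ exists a b x s,
     [/\ g = qdiff a b, grF gr a x, grF gr b s, s != 0 & z = x / s]].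

Definition is_hom_ideal (M : nmodType) (R : idomainType) (gr : M -> set R)
    (A : set {fraction R}) : Prop :=
  is_ideal A /\ internal_direct_sum A (fun a => A `&` grF gr a).

(* The set HF(R) *)
Definition hom_frac_ideals (M : nmodType) (R : idomainType) (gr : M -> set R) :
  set (set {fraction R}) :=
  [set A | @frac_ideals R A /\
           exists2 s, hom_elts gr s & is_hom_ideal gr (scale s A)].

(* C(f), for f in R_H *)
Definition content_elt (M : nmodType) (R : idomainType) (gr : M -> set R)
    (f : {fraction R}) : set {fraction R} :=
  span [set y | exists c g, decomposition (hom_loc_gr gr) f c /\ y = c g].

(* C(I), for I contained in R_H *)
Definition content (M : nmodType) (R : idomainType) (gr : M -> set R)
    (I : set {fraction R}) : set {fraction R} :=
  span (\bigcup_(f in I) content_elt gr f).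

(** ** Star operations

    A star operation on a family F of fractional ideals is represented by a
    map on all subsets of {fraction R}; its values outside F are irrelevant. *)

Definition star_operation (R : idomainType) (X : set {fraction R})
    (F : set (set {fraction R})) (star : set {fraction R} -> set {fraction R}) :
  Prop :=
  (forall A, F A -> F (star A)) /\
  [/\ forall x, X x -> x != 0 -> star (principal x) = principal x,
      forall x A, X x -> x != 0 -> F A -> star (scale x A) = scale x (star A),
      forall A, F A -> A `<=` star A,
      forall A B, F A -> F B -> A `<=` B -> star A `<=` star B
    & forall A, F A -> star (star A) = star A].

Definition classical_star (R : idomainType)
    (star : set {fraction R} -> set {fraction R}) : Prop :=
  star_operation [set: {fraction R}] (@frac_ideals R) star.

Definition hom_star (M : nmodType) (R : idomainType) (gr : M -> set R)
    (star : set {fraction R} -> set {fraction R}) : Prop :=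
  star_operation [set x | exists g, hom_loc_gr gr g x]
    (hom_frac_ideals gr) star.

(* star_f, for star a star operation on the family F *)
Definition finite_type (R : idomainType) (F : set (set {fraction R}))
    (star : set {fraction R} -> set {fraction R}) (A : set {fraction R}) :
  set {fraction R} :=
  \bigcup_(B in [set B | [/\ F B, fin_gen B & B `<=` A]]) star B.

(* e(star), for star a homogeneous star operation *)
Definition extension (M : nmodType) (R : idomainType) (gr : M -> set R)
    (star : set {fraction R} -> set {fraction R}) (A : set {fraction R}) :
  set {fraction R} :=
  \bigcap_(z in [set z | z != 0 /\ colon A z])
     scale z^-1 (star (content gr (scale z A))).

Definition maximal_elts (T : Type) (P : set (set T)) : set (set T) :=
  [set N | P N /\ forall J, P J -> N `<=` J -> J = N].

(* Max^star(R) *)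
Definition Max_star (R : idomainType)
    (star : set {fraction R} -> set {fraction R}) : set (set {fraction R}) :=
  maximal_elts [set I | [/\ is_ideal I, I != [set 0], star I = I
                          & I != @base_ring R]].

(* h-Max^star(R) *)
Definition hMax_star (M : nmodType) (R : idomainType) (gr : M -> set R)
    (star : set {fraction R} -> set {fraction R}) : set (set {fraction R}) :=
  maximal_elts [set I | [/\ is_hom_ideal gr I, I != [set 0], star I = I
                          & I != @base_ring R]].

(* Main.v *)
From mathcomp Require Import all_boot all_order all_algebra.
From mathcomp Require Import boolp classical_sets cardinality fsbigop.
Require Import Defs.

(* Write e for the extension of star_f and C for the content. A homogeneous
   star_f-ideal I is an e_f-ideal: for B contained in I, the choice z = 1 in the
   definition of e gives B^e in C(B)^(star_f), hence in I. Conversely, let J be a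
   proper e_f-ideal containing a nonzero homogeneous element; then C(J)^(star_f)
   is a proper homogeneous star_f-ideal containing J, and both inclusions follow
   by maximality.

   For the properness, suppose that 1 is in (s)^star for a finite set s of
   homogeneous components of elements r_i of J, let h be homogeneous in J, and
   let B = (h, r_1, ..., r_n). If zB is contained in R, then z = w / h with w in
   R, and the components of w r_i lie in hC(zB). By a weak Dedekind-Mertens lemma
   every element of s has a power that multiplies all components of w into
   hC(zB)^(star_f). Since 1 is in (s)^star, factors from s can be cancelled one at
   a time, so w is in hC(zB)^(star_f), that is, z is in C(zB)^(star_f). As z was
   arbitrary, 1 is in B^e, hence in J. *)

Set Implicit Arguments.
Unset Strict Implicit.
Unset Printing Implicit Defensive.

Import GRing.Theory.

Local Open Scope ring_scope.
Local Open Scope classical_set_scope.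

(** * Unique sums and the Dedekind-Mertens lemma *)

(** The positive elements of a translation-invariant strict order, [x < y] being read as
    [P (y - x)]. *)
Definition positive_cone (G : zmodType) (P : set G) : Prop :=
  ~ P 0 /\ forall x y, P x -> P y -> P (x + y).

Lemma positive_cone_muln (G : zmodType) (P : set G) (x : G) (n : nat) :
  positive_cone P -> (0 < n)%N -> P x -> P (x *+ n).
Proof.
move=> [_ PD]; case: n => // n _ Px; elim: n => [|n IH]; first by rewrite mulr1n.
by rewrite mulrS; apply: PD.
Qed.

(* Otherwise the cone generated by [P] and [x] would be larger than [P]. *)
Lemma maximal_cone_neg (G : zmodType) (P : set G) (x : G) :
  torsion_free G -> positive_cone P ->
  (forall Q, P `<` Q -> ~ positive_cone Q) -> x != 0 -> ~ P x ->
  exists2 n, (0 < n)%N & P (- (x *+ n)).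
Proof.
move=> tf Pc maxP x0 nPx; apply: contrapT => nex.
pose P0 := [set p | p = 0 \/ P p].
have P0D p q : P0 p -> P0 q -> P0 (p + q).
  move=> [->|Pp] [->|Pq]; rewrite ?addr0 ?add0r; [by left|by right|by right|].
  by right; apply: Pc.2.
pose Q := [set y | P y \/ exists p n, [/\ P0 p, (0 < n)%N & y = p + x *+ n]].
apply: (maxP Q); first split.
- by move=> y Py; left.
- move=> /(_ x) QP; apply: nPx; apply: QP; right; exists 0, 1.
  by split; [left| |rewrite add0r].
split.
  (* If 0 were in [Q], either a positive multiple of [x] would vanish, against torsion-freeness, or
     its opposite would lie in [P]. *)
  case=> [/Pc.1//|[p [n [[->|Pp] n0 /esym e]]]].
    by move: x0; rewrite add0r in e; rewrite (tf _ _ n0 e) eqxx.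
  by apply: nex; exists n => //; rewrite -(addr0_eq e) opprK.
move=> y z [Py|[p [n [Pp n0 ->]]]] [Pz|[q [m [Pq m0 ->]]]].
- by left; apply: Pc.2.
- by right; exists (y + q), m; split=> //; [apply: P0D=> //; right|rewrite addrA].
- right; exists (p + z), n; split=> //; first by apply: P0D=> //; right.
  by rewrite addrAC.
- right; exists (p + q), (n + m)%N; split; first exact: P0D.
    by rewrite addn_gt0 n0.
  by rewrite mulrnDr addrACA.
Qed.

(** Zorn's lemma gives a maximal cone. If it missed both [x] and [- x], it would contain some
    [- n x] and some [m x], hence 0, the sum of [m] times the first and [n] times the second. *)
Lemma total_cone_exists (G : zmodType) : torsion_free G ->
  exists2 P : set G, positive_cone P & forall x, x != 0 -> P x \/ P (- x).
Proof.
move=> tf.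
have [|P [Pc maxP]] := @Zorn_bigcup G (@positive_cone G).
  move=> F Fc Ftot; split; first by move=> [A FA A0]; case: (Fc _ FA).
  move=> x y [A FA Ax] [B FB By].
  have [AB|BA] := Ftot _ _ FA FB.
    by exists B => //; apply: (Fc _ FB).2 => //; apply: AB.
  by exists A => //; apply: (Fc _ FA).2 => //; apply: BA.
exists P => // x x0; apply: contrapT => /not_orP[nPx nPNx].
have [n n0 Pn] := maximal_cone_neg tf Pc maxP x0 nPx.
have [m m0 Pm] : exists2 m, (0 < m)%N & P (- (- x *+ m)).
  by apply: maximal_cone_neg; rewrite ?oppr_eq0.
apply: Pc.1; rewrite -(subrr (x *+ n *+ m)) addrC; apply: Pc.2.
  by rewrite -mulNrn; apply: positive_cone_muln.
rewrite mulrnAC; apply: positive_cone_muln => //.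
by rewrite mulNrn opprK in Pm.
Qed.

(** The unique product property, in additive notation; repetitions in the lists are harmless, as
    only values are compared. *)
Definition unique_sums (M : nmodType) : Prop :=
  forall s t : seq M, s != [::] -> t != [::] ->
  exists a b, [/\ a \in s, b \in t &
    forall c d, c \in s -> d \in t -> c + d = a + b -> c = a /\ d = b].

(** For the order given by a total cone, the largest element of [s] plus the largest of [t] exceeds
    every other sum. *)
Lemma unique_sums_torsion_free (G : zmodType) : torsion_free G -> unique_sums G.
Proof.
move=> tf; have [P Pc Ptot] := total_cone_exists tf.
have max_ex (s : seq G) : s != [::] ->
    exists2 a, a \in s & forall b, b \in s -> b = a \/ P (a - b).
  elim: s => // x [|y s] IH _.
    by exists x; [exact: mem_head|move=> b; rewrite inE => /eqP; left].
  have [//|a als amax] := IH.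
  have [xa|xa] := eqVneq x a.
    by exists a; [rewrite inE als orbT|move=> b /predU1P[->|/amax//]; left].
  have [Pxa|Pax] := Ptot (x - a) ltac:(by rewrite subr_eq0).
    exists x; first exact: mem_head.
    move=> b /predU1P[->|/amax[->|Pab]]; [by left|by right|right].
    by rewrite -(subrKA a); apply: Pc.2.
  exists a; first by rewrite inE als orbT.
  by move=> b /predU1P[->|/amax//]; right; rewrite -opprB.
move=> s t /max_ex[a als amax] /max_ex[b blt bmax]; exists a, b; split=> // c d.
move=> cs dt e; have {}e : (a - c) + (b - d) = 0 by rewrite addrACA -opprD e subrr.
case: (amax _ cs) (bmax _ dt) => [ca|Pac] [db|Pbd] //.
- by case: Pc.1; rewrite -e ca subrr add0r.
- by case: Pc.1; rewrite -e db subrr addr0.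
- by case: Pc.1; rewrite -e; apply: Pc.2.
Qed.

Lemma qdiff_inj (M : nmodType) : cancellative M ->
  forall a c : M, qdiff a 0 = qdiff c 0 -> a = c.
Proof.
move=> canc a c /qdiffP[k]; rewrite !addr0 ![_ + k]addrC; exact: canc.
Qed.

(** Cancellativity embeds the monoid in its quotient group, from which the property is pulled
    back. *)
Lemma unique_sums_torsionless (M : nmodType) :
  cancellative M -> torsionless M -> unique_sums M.
Proof.
move=> canc tl s t s0 t0; pose q (a : M) := qdiff a 0.
have qinj : injective q by apply: qdiff_inj.
have qD a b : q (a + b) = q a + q b.
  by rewrite /q -{1}[0](addr0 0) -qg_addE.
have map0 (r : seq M) : r != [::] -> map q r != [::] by case: r.
have [_ [_ [/mapP[a as_ ->] /mapP[b bt ->] uab]]] :=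
  unique_sums_torsion_free tl (map0 _ s0) (map0 _ t0).
exists a, b; split=> // c d cs dt cd.
have [|/qinj-> /qinj->//] := uab _ _ (map_f q cs) (map_f q dt).
by rewrite -!qD cd.
Qed.

Definition ideal_set (R : comNzRingType) (V : set R) : Prop :=
  [/\ V 0, forall x y, V x -> V y -> V (x + y) & forall r x, V x -> V (r * x)].

Lemma ideal_set_colon (R : comNzRingType) (V : set R) (u : R) :
  ideal_set V -> ideal_set [set x | V (u * x)].
Proof.
move=> [V0 VD VM]; split=> [|x y /= Vx Vy|r x /= Vx] /=.
- by rewrite mulr0.
- by rewrite mulrDr; apply: VD.
- by rewrite mulrCA; apply: VM.
Qed.

Lemma ideal_set_sum (R : comNzRingType) (V : set R) (I : eqType) (r : seq I)
    (P : pred I) (F : I -> R) : ideal_set V ->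
  (forall i, i \in r -> P i -> V (F i)) -> V (\sum_(i <- r | P i) F i).
Proof.
move=> [V0 VD _] VF; rewrite big_seq_cond; apply: big_ind => //.
by move=> i /andP[]; apply: VF.
Qed.

(** The degree [d] coefficient of a product in the monoid algebra, the factors being [F] restricted
    to [s] and [W] restricted to [t]. *)
Definition convolution (M : nmodType) (R : pzRingType) (s t : seq M)
    (F W : M -> R) (d : M) : R :=
  \sum_(a <- s) \sum_(b <- t | a + b == d) F a * W b.

(* A weak form of the Dedekind-Mertens lemma. The induction removes a pair with a
   unique sum [a + b], whose coefficient in [F * W] is [F a * W b]. *)
Lemma convolution_nilpotent (M : nmodType) (R : comNzRingType) (V : set R)
    (F W : M -> R) (s t : seq M) :
  unique_sums M -> ideal_set V -> uniq s -> uniq t ->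
  (forall d, V (convolution s t F W d)) ->
  forall a, a \in s -> exists N, forall b, b \in t -> V (F a ^+ N * W b).
Proof.
move=> us; have [n] := ubnP (size s + size t)%N.
elim: n => // n IH in V s t *; rewrite ltnS => szn Vi us_ ut VFW.
have [V0 VD VM] := Vi.
have VN x : V x -> V (- x) by rewrite -mulN1r; apply: VM.
have [->|t0] := eqVneq t [::]; first by move=> a _; exists 0%N.
have [->//|s0] := eqVneq s [::].
have [m [k [ms kt umk]]] := us _ _ s0 t0.
have Vmk : V (F m * W k).
  have := VFW (m + k); rewrite /convolution (bigD1_seq m)//= [X in _ + X]big_seq_cond.
  rewrite [X in _ + X]big1 ?addr0; last first.
    move=> c /andP[cs cm]; rewrite big_seq_cond big1// => d /andP[dt /eqP e].
    by have [e' _] := umk _ _ cs dt e; rewrite e' eqxx in cm.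
  rewrite big_mkcond (bigD1_seq k)//= eqxx big_seq_cond.
  rewrite big1 ?addr0//.
  move=> d /andP[dt dk]; case: eqP => // e.
  by have [_ e'] := umk _ _ ms dt e; rewrite e' eqxx in dk.
have szs : size (rem m s) = (size s).-1 by rewrite size_rem.
have szt : size (rem k t) = (size t).-1 by rewrite size_rem.
have s1 : (0 < size s)%N by case: (s) s0.
have t1 : (0 < size t)%N by case: (t) t0.
(* Dropping [k] from [t] changes the convolution by multiples of [W k], which [F m] sends into [V];
   the induction thus applies with [V] replaced by its colon by [F m]. *)
have nilm : exists N, forall b, b \in t -> V (F m ^+ N * W b).
  have [| | | | |N VN'] := IH [set x | V (F m * x)] s (rem k t) _ _ _ _ _ m ms => //.
  - by rewrite szt; apply: leq_trans szn; rewrite -addnS prednK.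
  - exact: ideal_set_colon.
  - exact: rem_uniq.
  - move=> d /=.
    have -> : convolution s (rem k t) F W d =
        convolution s t F W d - \sum_(a <- s | a + k == d) F a * W k.
      apply/eqP; rewrite eq_sym subr_eq; apply/eqP.
      rewrite /convolution (big_mkcond (fun a => a + k == d)) -big_split/=.
      apply: eq_bigr => a _; rewrite (perm_big _ (perm_to_rem kt))/= big_cons.
      by case: ifP => _; [rewrite addrC | rewrite addr0].
    rewrite mulrBr; apply: VD; first exact: VM.
    apply: VN; rewrite mulr_sumr; apply: ideal_set_sum => // a _ _.
    by rewrite mulrCA; apply: VM.
  exists N.+1 => b bt; have [->|bk] := eqVneq b k.
    by rewrite exprS -mulrA mulrCA; apply: VM.
  by rewrite exprS -mulrA; apply: VN'; rewrite mem_rem_uniq// inE bk.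
move=> a as_; have [->//|am] := eqVneq a m.
have [K VK] := nilm.
(* The powers of [F m] are traded for powers of [F a] one at a time, from [F m ^+ K] down to
   [F m ^+ 0]. *)
suff main j : (j <= K)%N ->
    exists N, forall b, b \in t -> V (F m ^+ (K - j) * (F a ^+ N * W b)).
  by have [N HN] := main K (leqnn _); exists N => b /HN; rewrite subnn mul1r.
elim: j => [_|j IHj jK].
  by exists 0%N => b bt; rewrite subn0 mul1r; apply: VK.
have [N HN] := IHj (ltnW jK).
(* Since [u * F m] sends every [W b] into [V], dropping [m] from [s] is harmless once [V] is
   replaced by its colon by [u]. *)
pose u := F m ^+ (K - j.+1) * F a ^+ N.
have [| | | | | |N' HN'] := IH [set x | V (u * x)] (rem m s) t _ _ _ _ _ a _ => //.
- by rewrite szs; apply: leq_trans szn; rewrite -addSn prednK.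
- exact: ideal_set_colon.
- exact: rem_uniq.
- move=> d /=.
  have -> : convolution (rem m s) t F W d =
      convolution s t F W d - \sum_(b <- t | m + b == d) F m * W b.
    apply/eqP; rewrite eq_sym subr_eq; apply/eqP.
    by rewrite /convolution (perm_big _ (perm_to_rem ms))/= big_cons addrC.
  rewrite mulrBr; apply: VD; first exact: VM.
  apply: VN; rewrite mulr_sumr; apply: ideal_set_sum => // b bt _.
  have -> : u * (F m * W b) = F m ^+ (K - j) * (F a ^+ N * W b).
    by rewrite -(subnSK jK) exprSr mulrACA.
  exact: HN.
- by rewrite mem_rem_uniq// inE am.
exists (N + N')%N => b bt; rewrite exprD -mulrA mulrA.
exact: HN'.
Qed.

(** * Homogeneous components *)

Lemma decompositionP (I : choiceType) (V : zmodType) (D : I -> set V) (x : V)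
    (c : I -> V) :
  decomposition D x c <->
  (forall i, D i (c i)) /\ exists s, [/\ uniq s, forall i, i \notin s -> c i = 0
    & x = \sum_(i <- s) c i].
Proof.
have sumE (s : seq I) : uniq s -> (forall i, i \notin s -> c i = 0) ->
    \sum_(i \in [set: I]) c i = \sum_(i <- s) c i.
  move=> us cs; rewrite (fsbigE s)//; first by apply: eq_bigl => i; rewrite in_setT.
  by move=> i _; apply: cs.
split=> [[Dc /finite_seqP[s e] ->]|[Dc [s [us cs ->]]]].
  split=> //; exists (undup s).
  have cs i : i \notin undup s -> c i = 0.
    rewrite mem_undup; apply: contraNeq => ci.
    by have : [set i | c i != 0] i by []; rewrite e.
  by split; [exact: undup_uniq| |apply: (sumE _ (undup_uniq s))].
split=> //; last by rewrite (sumE s).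
apply: (sub_finite_set _ (finite_seq s)) => i /= ci.
by apply: contraNT ci => /cs->.
Qed.

Lemma sum_uniq_sub (I : eqType) (V : nmodType) (F : I -> V) (s t : seq I) :
  uniq s -> uniq t -> {subset s <= t} -> (forall i, i \notin s -> F i = 0) ->
  \sum_(i <- s) F i = \sum_(i <- t) F i.
Proof.
move=> us ut st F0; rewrite [RHS](bigID (mem s))/= [X in _ + X]big1// addr0.
rewrite -[RHS]big_filter; apply: perm_big; apply: uniq_perm => //.
  exact: filter_uniq.
by move=> i; rewrite mem_filter /=; case: (boolP (i \in s)) => //= /st->.
Qed.

(** The decomposition is picked by choice; the zero default is never reached when [gr] is a
    grading. *)
Definition component (M : nmodType) (R : idomainType) (gr : M -> set R) (r : R) :
    M -> R :=
  if pselect (exists c, decomposition gr r c) is left h then projT1 (cid h)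
  else fun=> 0.

Section Grading.
Variables (M : nmodType) (R : idomainType) (gr : M -> set R).
Hypothesis gr_grading : is_grading gr.

Lemma grading0 a : gr a 0.
Proof. by have [/(_ a)[]] := gr_grading. Qed.

Lemma gradingB a x y : gr a x -> gr a y -> gr a (x - y).
Proof. by have [/(_ a)[_ grB] _ _] := gr_grading; apply: grB. Qed.

Lemma gradingD a x y : gr a x -> gr a y -> gr a (x + y).
Proof.
move=> x_a y_a; rewrite -[y]opprK; apply: gradingB => //.
by rewrite -sub0r; apply: gradingB => //; apply: grading0.
Qed.

Lemma gradingM a b x y : gr a x -> gr b y -> gr (a + b) (x * y).
Proof. by have [_ grM _] := gr_grading; apply: grM. Qed.

Lemma componentP r : decomposition gr r (component gr r).
Proof.
rewrite /component; case: pselect => [h|[]]; first by case: cid.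
by have [_ _ [_ /(_ r I)[c []]]] := gr_grading; exists c.
Qed.

Lemma component_unique r c : decomposition gr r c -> component gr r = c.
Proof.
have [_ _ [_ /(_ r I)[d [_ uniq_d]]]] := gr_grading => /uniq_d <-.
by apply/esym/uniq_d/componentP.
Qed.

Lemma component_gr r a : gr a (component gr r a).
Proof. by have [] := componentP r. Qed.

Lemma component_support r : exists s, [/\ uniq s,
  forall a, a \notin s -> component gr r a = 0
  & r = \sum_(a <- s) component gr r a].
Proof. by have /decompositionP[] := componentP r. Qed.

Lemma component_hom a x b : gr a x ->
  component gr x b = if b == a then x else 0.
Proof.
move=> x_a; rewrite (@component_unique x (fun b => if b == a then x else 0))//.
apply/decompositionP; split=> [i|].
  by case: eqP => [->|_] //; apply: grading0.
exists [:: a]; split=> // [i|]; last by rewrite big_seq1 eqxx.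
by rewrite inE => /negbTE->.
Qed.

Lemma component0 a : component gr 0 a = 0.
Proof. by rewrite (component_hom _ (grading0 a)); case: eqP. Qed.

Lemma componentD x y a : component gr (x + y) a = component gr x a + component gr y a.
Proof.
rewrite (@component_unique _ (fun a => component gr x a + component gr y a))//.
have [s [us xs ex]] := component_support x.
have [t [ut yt ey]] := component_support y.
apply/decompositionP; split=> [b|].
  exact: gradingD (component_gr _ _) (component_gr _ _).
exists (undup (s ++ t)); split; first exact: undup_uniq.
  by move=> b; rewrite mem_undup mem_cat => /norP[/xs-> /yt->]; rewrite addr0.
rewrite big_split {1}ex {1}ey /=; congr (_ + _); apply: sum_uniq_sub => //;
  rewrite ?undup_uniq// => b bs; by rewrite mem_undup mem_cat bs ?orbT.
Qed.

Lemma component_sum (I : Type) (s : seq I) (P : pred I) (F : I -> R) a :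
  component gr (\sum_(i <- s | P i) F i) a =
  \sum_(i <- s | P i) component gr (F i) a.
Proof.
apply: (big_morph (fun x => component gr x a)) => [x y|].
  exact: componentD.
exact: component0.
Qed.

Lemma component_mul x y s t d :
  x = \sum_(a <- s) component gr x a -> y = \sum_(b <- t) component gr y b ->
  component gr (x * y) d = convolution s t (component gr x) (component gr y) d.
Proof.
move=> {1}-> {1}->; rewrite big_distrlr /= component_sum; apply: eq_bigr => a _.
rewrite component_sum [RHS]big_mkcond; apply: eq_bigr => b _.
rewrite (component_hom _ (gradingM (component_gr x a) (component_gr y b))).
by rewrite eq_sym.
Qed.

(** Degrees form only a monoid, so an arbitrary [d] need not be of the form [e + b]. This lets
    [component_homMD] be applied to any nonzero component. *)
Lemma component_homM e h r d : gr e h -> component gr (h * r) d != 0 ->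
  exists b, d = e + b.
Proof.
move=> h_e; have [t [ut rt er]] := component_support r.
rewrite (@component_mul h r [:: e] t d)//; last first.
  by rewrite big_seq1 (component_hom _ h_e) eqxx.
rewrite /convolution big_seq1; apply: contra_neqP => nex.
rewrite big1// => b /eqP eb; case: nex; by exists b.
Qed.

Lemma component_homMD e h r b : cancellative M -> gr e h ->
  component gr (h * r) (e + b) = h * component gr r b.
Proof.
move=> canc h_e; have [t [ut rt er]] := component_support r.
rewrite (@component_mul h r [:: e] t)//; last first.
  by rewrite big_seq1 (component_hom _ h_e) eqxx.
rewrite /convolution big_seq1 (component_hom _ h_e) eqxx.
rewrite (eq_bigl (pred1 b)) => [|c]; last by rewrite (inj_eq (canc e)).
have [bt|bt] := boolP (b \in t).
  by rewrite -big_filter filter_pred1_uniq// big_seq1.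
rewrite (rt _ bt) mulr0 big_seq_cond big1// => c /andP[ct /eqP cb].
by rewrite -cb ct in bt.
Qed.

(** Some component of 1 is nonzero. *)
Lemma homogeneous_nonzero : exists e h, gr e h /\ h != 0.
Proof.
apply: contrapT => nex; have [s [_ _ e]] := component_support 1.
have /eqP := oner_neq0 R; apply; rewrite e big1// => a _; apply: contrapT => /eqP.
by move=> n; apply: nex; exists a, (component gr 1 a); split=> //; apply: component_gr.
Qed.
End Grading.

(** * Homogeneous ideals *)

Section Submodules.
Variable R : idomainType.
Implicit Types (A B S : set {fraction R}).

Lemma span_submodule S : submodule (span S).
Proof.
split=> [A [[]]//|x y Sx Sy A AS|r x Sx A AS]; have [[A0 AD AM] _] := AS.
- exact: AD (Sx _ AS) (Sy _ AS).
- exact: AM (Sx _ AS).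
Qed.

Lemma sub_span S : S `<=` span S.
Proof. exact: sub_gen_smallest. Qed.

Lemma span_sub S A : submodule A -> S `<=` A -> span S `<=` A.
Proof. exact: smallest_sub. Qed.

Lemma span_mono S T : S `<=` T -> span S `<=` span T.
Proof.
by move=> ST; apply: span_sub (span_submodule _) _ => x /ST; apply: sub_span.
Qed.

Lemma submodule_sum A (I : eqType) (r : seq I) (P : pred I) (F : I -> {fraction R}) :
  submodule A -> (forall i, i \in r -> P i -> A (F i)) ->
  A (\sum_(i <- r | P i) F i).
Proof.
move=> [A0 AD _] AF; rewrite big_seq_cond; apply: big_ind => //.
by move=> i /andP[]; apply: AF.
Qed.

Lemma base_ring_submodule : submodule (@base_ring R).
Proof.
split; first by exists 0; rewrite ?tofrac0.
- by move=> _ _ [x _ <-] [y _ <-]; exists (x + y); rewrite ?tofracD.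
- by move=> r _ [x _ <-]; exists (r * x); rewrite ?tofracM.
Qed.

Lemma submodule_scale x A : submodule A -> submodule (scale x A).
Proof.
move=> [A0 AD AM]; split; first by exists 0; rewrite ?mulr0.
- by move=> _ _ [a Aa <-] [b Ab <-]; exists (a + b); [exact: AD|rewrite mulrDr].
- by move=> r _ [a Aa <-]; exists (r%:F * a); [exact: AM|rewrite mulrCA].
Qed.

Lemma scaleA x y A : scale x (scale y A) = scale (x * y) A.
Proof.
apply/seteqP; split=> [_ [_ [a Aa <-] <-]|_ [a Aa <-]].
  by exists a; rewrite ?mulrA.
by exists (y * a); [exists a|rewrite mulrA].
Qed.

Lemma scale1 A : scale 1 A = A.
Proof.
apply/seteqP; split=> [_ [a Aa <-]|a Aa]; first by rewrite mul1r.
by exists a; rewrite ?mul1r.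
Qed.

Lemma scale_span x S : scale x (span S) = span (scale x S).
Proof.
apply/seteqP; split; last first.
  apply: span_sub; first exact/submodule_scale/span_submodule.
  by move=> _ [a Sa <-]; exists a => //; apply: sub_span.
suff: span S `<=` [set y | span (scale x S) (x * y)] by move=> h _ [a /h + <-].
have [S0 SD SM] := span_submodule (scale x S).
apply: span_sub; last by move=> a Sa; apply: sub_span; exists a.
split=> [|a b /= Sa Sb|r a /= Sa] /=; first by rewrite mulr0.
  by rewrite mulrDr; apply: SD.
by rewrite mulrCA; apply: SM.
Qed.

(** The elements spanned by some finite part of [S] already form a submodule containing [S]. *)
Lemma span_finite S y : span S y ->
  exists s : seq {fraction R}, [set` s] `<=` S /\ span [set` s] y.
Proof.
suff: span S `<=` [set y | exists s : seq {fraction R},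
    [set` s] `<=` S /\ span [set` s] y] by apply.
apply: span_sub => [|x Sx]; last first.
  exists [:: x]; split=> [z|]; first by rewrite /= inE => /eqP->.
  by apply: sub_span; rewrite /= inE.
split=> [|x z [s [sS sx]] [t [tS tz]]|r x [s [sS sx]]].
- by exists [::]; split=> //; have [] := span_submodule [set` @nil {fraction R}].
- exists (s ++ t); split.
    by move=> w /=; rewrite mem_cat => /orP[/sS|/tS].
  have [_ SD _] := span_submodule [set` s ++ t].
  by apply: SD; [move: x sx|move: z tz]; apply: span_mono => w /= w_in;
    rewrite mem_cat w_in ?orbT.
- by exists s; split=> //; have [_ _] := span_submodule [set` s]; apply.
Qed.

Lemma fin_genP A : fin_gen A <-> exists s : seq {fraction R}, A = span [set` s].
Proof.
split=> [[S /finite_seqP[s ->] ->]|[s ->]]; first by exists s.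
by exists [set` s].
Qed.

Lemma fin_gen_sub_span A S : fin_gen A -> A `<=` span S ->
  exists s : seq {fraction R}, [set` s] `<=` S /\ A `<=` span [set` s].
Proof.
move=> /fin_genP[s ->] AS.
have {AS} sS : [set` s] `<=` span S by apply: subset_trans AS; apply: sub_span.
suff [t [tS st]] : exists t : seq {fraction R},
    [set` t] `<=` S /\ [set` s] `<=` span [set` t].
  by exists t; split=> //; apply: span_sub st; apply: span_submodule.
elim: s sS => [|x s IH] sS; first by exists [::].
have [|t [tS st]] := IH.
  by move=> z zs; apply: sS; rewrite /= inE (zs : z \in s) orbT.
have [|u [uS ux]] := @span_finite S x; first by apply: sS; rewrite /= mem_head.
exists (t ++ u); split; first by move=> w /=; rewrite mem_cat => /orP[/tS|/uS].
move=> z /=; rewrite inE => /orP[/eqP->|/st]; [move: ux|]; apply: span_mono => w /= w_in;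
    by rewrite mem_cat w_in ?orbT.
Qed.

Lemma nonzero_subset A B : submodule A -> A `<=` B -> A != [set 0] -> B != [set 0].
Proof.
move=> [A0 _ _] AB; apply: contra_neq => B0; apply/seteqP; split=> [x /AB|_ ->//].
by rewrite B0.
Qed.

Lemma nonzero_elt A : submodule A -> A != [set 0] -> exists2 x, A x & x != 0.
Proof.
move=> [A0 _ _] An; apply: contrapT => nex; move/eqP: An; apply.
apply/seteqP; split=> [x Ax|_ ->//]; apply: contrapT => /eqP x0; apply: nex.
by exists x.
Qed.

Lemma elt_nonzero A x : A x -> x != 0 -> A != [set 0].
Proof. by move=> Ax x0; apply: contra_neqN x0 => /eqP A0; move: Ax; rewrite A0 => ->. Qed.

Lemma frac_ideal_ideal A : is_ideal A -> A != [set 0] -> frac_ideals A.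
Proof.
by move=> [sA AR] An; split=> //; exists 1; rewrite ?oner_neq0// tofrac1 scale1.
Qed.
End Submodules.

(** * Homogeneity of ideals in terms of components, spans and scaling *)

Section HomogeneousIdeals.
Variables (M : nmodType) (R : idomainType) (gr : M -> set R).
Hypothesis gr_grading : is_grading gr.
Implicit Types (A B S : set {fraction R}).

(** The decomposition lifts along the embedding of [R] in its field of fractions, and the grading of
    [R] gives uniqueness there. *)
Lemma decomposition_tofrac A r c :
  decomposition (fun a => A `&` grF gr a) r%:F c ->
  c = fun a => (component gr r a)%:F.
Proof.
move=> /decompositionP[Dc [s [us cs e]]].
have /choice[d dP] a : exists y, gr a y /\ c a = y%:F.
  by have [_ [y ya <-]] := Dc a; exists y.
rewrite (component_unique gr_grading (c := d)).
  by apply/funext => a; case: (dP a).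
apply/decompositionP; split=> [a|]; first by case: (dP a).
exists s; split=> // [a /cs/eqP|]; first by rewrite (dP a).2 tofrac_eq0 => /eqP.
apply/eqP; rewrite -tofrac_eq e raddf_sum; apply/eqP.
by apply: eq_bigr => a _; case: (dP a).
Qed.

Lemma hom_idealP A : is_hom_ideal gr A <->
  is_ideal A /\ forall r a, A r%:F -> A (component gr r a)%:F.
Proof.
split=> [[iA [_ dA]]|[iA cA]]; split=> //.
  move=> r a /dA[c [dc _]]; have := decomposition_tofrac dc.
  by have [Ac _ _] := dc; have [Aca _] := Ac a => cE; rewrite cE in Aca.
split=> [a x []//|x Ax]; have [_ /(_ _ Ax)[r _ e]] := iA; subst x.
exists (fun a => (component gr r a)%:F); split; last by move=> d /decomposition_tofrac.
apply/decompositionP; split=> [a|].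
  split; first exact: cA.
  by exists (component gr r a) => //; apply: component_gr.
have [s [us rs er]] := component_support gr_grading r.
exists s; split=> // [a /rs->|]; first exact: tofrac0.
by rewrite {1}er raddf_sum.
Qed.

Lemma hom_ideal_span S : (forall x, S x -> exists a, grF gr a x) ->
  is_hom_ideal gr (span S).
Proof.
move=> Sh; have [S0 SD SM] := span_submodule S.
have SR : span S `<=` @base_ring R.
  apply: span_sub (base_ring_submodule R) _ => x /Sh[a [y _ <-]].
  by exists y.
apply/hom_idealP; split=> //.
(* The elements with all components in [span S] form a submodule; closure under [R] follows by
   expanding the components of a product. *)
suff SP : span S `<=` [set x | exists r, [/\ x = r%:F, span S x &
    forall a, span S (component gr r a)%:F]].
  by move=> r a /SP[r' [/eqP]]; rewrite tofrac_eq => /eqP->.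
apply: span_sub => [|x Sx]; last first.
  have [a [y ya yx]] := Sh _ Sx; exists y; split=> [//||b]; first exact: sub_span.
  rewrite (component_hom gr_grading b ya).
  by case: eqP => _; rewrite ?yx ?tofrac0//; apply: sub_span.
split=> [|_ _ [x [-> Sx xP]] [y [-> Sy yP]]|r _ [x [-> Sx xP]]].
- by exists 0; split=> [||a]; rewrite ?tofrac0// component0// tofrac0.
- exists (x + y); split=> [||a]; rewrite ?tofracD//; first exact: SD.
  by rewrite componentD// tofracD; apply: SD.
- exists (r * x); split=> [||d]; rewrite ?tofracM//; first exact: SM.
  have [s [_ _ rE]] := component_support gr_grading r.
  have [t [_ _ xE]] := component_support gr_grading x.
  rewrite (component_mul gr_grading d rE xE) raddf_sum /=.
  apply: submodule_sum => // a _ _; rewrite raddf_sum.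
  by apply: submodule_sum => // b _ _ /=; rewrite tofracM; apply: SM.
Qed.

Lemma hom_ideal_scale a x A : cancellative M -> gr a x ->
  is_hom_ideal gr A -> is_hom_ideal gr (scale x%:F A).
Proof.
move=> canc xa /hom_idealP[[sA AR] cA]; apply/hom_idealP.
split; first split; first exact: submodule_scale.
  by move=> _ [y /AR[r _ <-] <-]; exists (x * r); rewrite ?tofracM.
move=> r d [y Ay]; have [r' _ e] := AR _ Ay; rewrite -e in Ay *.
move=> /eqP; rewrite -tofracM tofrac_eq => /eqP <-.
have [->|] := eqVneq (component gr (x * r') d) 0.
  by exists 0; [case: sA|rewrite mulr0 tofrac0].
move=> /(component_homM gr_grading xa)[b ->].
rewrite (component_homMD gr_grading) // tofracM.
by exists (component gr r' b)%:F => //; apply: cA.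
Qed.

Lemma hom_ideal_unscale a x A : cancellative M -> gr a x -> x != 0 ->
  is_hom_ideal gr (scale x%:F A) -> is_ideal A -> is_hom_ideal gr A.
Proof.
move=> canc xa x0 /hom_idealP[_ cA] iA; apply/hom_idealP; split=> // r b Ar.
have [|y Ay] := cA (x * r) (a + b); first by exists r%:F; rewrite ?tofracM.
rewrite (component_homMD gr_grading)// tofracM => /mulfI.
by rewrite tofrac_eq0 => /(_ x0) <-.
Qed.

Lemma hom_elts_exist : exists h, hom_elts gr h.
Proof.
have [e [h [he h0]]] := homogeneous_nonzero gr_grading.
by exists h%:F; split; [rewrite tofrac_eq0|exists e, h].
Qed.

Lemma hom_elts_base h : hom_elts gr h -> exists e y, [/\ gr e y, y != 0 & h = y%:F].
Proof.
move=> [h0 [e [y ye yE]]]; exists e, y; split=> [//||].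
  by rewrite -tofrac_eq0 yE.
by rewrite yE.
Qed.

Lemma hom_frac_ideal_ideal A : cancellative M -> is_hom_ideal gr A ->
  A != [set 0] -> hom_frac_ideals gr A.
Proof.
move=> canc hA An; split; first by apply: frac_ideal_ideal => //; case: hA.
have [h hh] := hom_elts_exist; exists h => //.
by have [e [y [ye _ ->]]] := hom_elts_base hh; apply: hom_ideal_scale ye hA.
Qed.

Lemma hom_ideal_hom_frac_ideal A : cancellative M -> hom_frac_ideals gr A ->
  A `<=` @base_ring R -> is_hom_ideal gr A.
Proof.
move=> canc [[sA _ _] [h hh hA]] AR; have [e [y [ye y0 hE]]] := hom_elts_base hh.
by apply: (hom_ideal_unscale canc ye y0) => //; rewrite -hE.
Qed.

Lemma hom_frac_ideal_scale A u h d e : cancellative M ->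
  gr d u -> u != 0 -> gr e h -> h != 0 ->
  is_hom_ideal gr A -> A != [set 0] ->
  hom_frac_ideals gr (scale (u%:F / h%:F) A).
Proof.
move=> canc ud u0 he h0 hA An.
have uhE : h%:F * (u%:F / h%:F) = u%:F by rewrite mulrC divfK// tofrac_eq0.
have [[sA AR] _] := hA.
have hS : is_hom_ideal gr (scale u%:F A) by apply: hom_ideal_scale ud hA.
split; first split; first exact: submodule_scale.
- have [x Ax x0] := nonzero_elt sA An.
  apply: (@elt_nonzero _ _ (u%:F / h%:F * x)); first by exists x.
  by rewrite !mulf_neq0// ?invr_eq0 tofrac_eq0.
- by exists h => //; rewrite scaleA uhE; case: hS => -[].
exists h%:F; last by rewrite scaleA uhE.
by split; [rewrite tofrac_eq0|exists e, h].
Qed.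
End HomogeneousIdeals.

(** * Contents *)

Section Content.
Variables (M : nmodType) (R : idomainType) (gr : M -> set R).
Hypotheses (canc : cancellative M) (gr_grading : is_grading gr).
Implicit Types (A I S : set {fraction R}).

(** Clears denominators in finitely many degrees of [R_H]. Zero values are excluded because their
    degree [g] need not be of the form [qdiff d e] for the chosen [e]. *)
Lemma common_denominator (c : quotient_group M -> {fraction R})
    (s : seq (quotient_group M)) :
  (forall g, hom_loc_gr gr g (c g)) ->
  exists e h, [/\ gr e h, h != 0 & forall g, g \in s -> c g != 0 ->
    exists d y, [/\ gr d y, h%:F * c g = y%:F & g = qdiff d e]].
Proof.
move=> cP; elim: s => [|g s [e [h [he h0 hs]]]].
  by have [e [h [he h0]]] := homogeneous_nonzero gr_grading; exists e, h; split.
have [cg0|cg0] := eqVneq (c g) 0.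
  exists e, h; split=> // g' /predU1P[->|/hs//]; first by rewrite cg0 eqxx.
have [/eqP|[a [b [_ [_ [gE [x xa <-] [t tb <-] t0 cE]]]]]] := cP g.
  by rewrite (negbTE cg0).
exists (e + b), (h * t); split.
- exact: gradingM.
- by rewrite mulf_neq0// -tofrac_eq0.
move=> g' /predU1P[->|g's] cg'0.
  exists (e + a), (h * x); split; first exact: gradingM.
    by rewrite cE !tofracM -mulrA [t%:F * _]mulrC divfK.
  rewrite gE; apply/qdiffP; exists 0; rewrite !addr0.
  by rewrite addrCA addrA.
have [d [y [yd yE gE']]] := hs _ g's cg'0.
exists (d + b), (y * t); split; first exact: gradingM.
  by rewrite !tofracM -yE mulrAC.
by rewrite gE'; apply/qdiffP; exists 0; rewrite !addr0 [e + b]addrC addrA.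
Qed.

(** The content is defined by decompositions in [R_H]; on elements of [R] they yield nothing but
    components in [R]. This is seen by comparing numerators over a common denominator [h] with the
    components of [h * r]. *)
Lemma loc_decomposition_component r c g :
  decomposition (hom_loc_gr gr) r%:F c ->
  c g = 0 \/ exists a, c g = (component gr r a)%:F.
Proof.
move=> /decompositionP[cP [s [us cs rE]]].
have [e [h [he h0 hs]]] := common_denominator s cP.
have [->|cg0] := eqVneq (c g) 0; [by left|right].
have /choice[f fP] k : exists p : M * R, c k != 0 ->
    [/\ gr p.1 p.2, h%:F * c k = p.2%:F & k = qdiff p.1 e].
  have [->|ck0] := eqVneq (c k) 0; first by exists (0, 0).
  have [|d [y yP]] := hs k _ ck0; first by apply: contraNT ck0 => /cs->.
  by exists (d, y).
pose y k := if c k == 0 then 0 else (f k).2.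
have yE k : h%:F * c k = (y k)%:F.
  rewrite /y; case: eqVneq => [->|/fP[]//]; by rewrite mulr0 tofrac0.
have hrE : h * r = \sum_(k <- s) y k.
  apply/eqP; rewrite -tofrac_eq tofracM rE mulr_sumr raddf_sum; apply/eqP.
  by apply: eq_bigr => k _; rewrite yE.
have gs : g \in s by apply: contraNT cg0 => /cs->.
(* The other numerators do not contribute: [k] is determined by the degree [(f k).1], since it
   equals [qdiff (f k).1 e]. *)
have cyg : component gr (h * r) (f g).1 = y g.
  have [fg1 fgE gE] := fP _ cg0.
  rewrite hrE (component_sum gr_grading) (bigD1_seq g)//= big1 ?addr0.
    by rewrite /y (negbTE cg0) (component_hom gr_grading _ fg1) eqxx.
  move=> k kg; rewrite /y; case: eqVneq => [_|/fP[fk1 _ kE]].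
    exact: component0.
  rewrite (component_hom gr_grading _ fk1); case: eqVneq => // fkg.
  by rewrite kE gE fkg eqxx in kg.
have yg0 : y g != 0 by rewrite -tofrac_eq0 -yE mulf_neq0// tofrac_eq0.
have [b fgb] : exists b, (f g).1 = e + b.
  by apply: (component_homM (r := r) gr_grading he); rewrite cyg; exact: yg0.
exists b; apply: (mulfI (x := h%:F)); first by rewrite tofrac_eq0.
by rewrite -tofracM -(component_homMD gr_grading _ _ canc he) -fgb cyg yE.
Qed.

Lemma loc_decomposition_exists r a : exists c,
  decomposition (hom_loc_gr gr) r%:F c /\ (component gr r a)%:F = c (qdiff a 0).
Proof.
have [s [us rs rE]] := component_support gr_grading r.
pose q (a : M) := qdiff a 0; have qinj : injective q by apply: qdiff_inj.
pose c g := \sum_(b <- s | q b == g) (component gr r b)%:F.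
have cq b : c (q b) = (component gr r b)%:F.
  rewrite /c (eq_bigl (pred1 b)) => [|d]; last by rewrite /= (inj_eq qinj).
  have [bs|bs] := boolP (b \in s).
    by rewrite -big_filter filter_pred1_uniq// big_seq1.
  rewrite rs// tofrac0 big_seq_cond big1// => d /andP[ds /eqP db].
  by rewrite -db ds in bs.
have c0 g : g \notin map q s -> c g = 0.
  move=> gs; rewrite /c big_seq_cond big1// => b /andP[bs /eqP bg].
  by rewrite -bg map_f in gs.
exists c; split; last by rewrite -cq.
apply/decompositionP; split=> [g|].
  have [/mapP[b bs ->]|/c0->] := boolP (g \in map q s); [right|by left].
  (* Degrees in [R_H] are witnessed by fractions, so the component is written with denominator [h],
     in degree [b + e] minus [e]. *)
  have [e [h [he h0]]] := homogeneous_nonzero gr_grading.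
  exists (b + e), e, (component gr r b * h)%:F, h%:F; split.
  - by apply/qdiffP; exists 0; rewrite !addr0.
  - exists (component gr r b * h) => //.
    by apply: gradingM => //; apply: component_gr.
  - by exists h.
  - by rewrite tofrac_eq0.
  - by rewrite cq tofracM mulfK// tofrac_eq0.
exists (map q s); split=> //; first by rewrite map_inj_uniq.
rewrite big_map {1}rE raddf_sum; apply: eq_bigr => b _ /=.
by rewrite cq.
Qed.

Definition components I : set {fraction R} :=
  [set y | exists r a, I r%:F /\ y = (component gr r a)%:F].

Lemma contentE I : I `<=` @base_ring R -> content gr I = span (components I).
Proof.
move=> IR; apply/seteqP; split; apply: span_sub (span_submodule _) _.
  move=> y [f If]; have [r _ fE] := IR _ If; rewrite -fE in If *.
  apply: span_sub (span_submodule _) _ y.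
  move=> _ [c [g [/loc_decomposition_component cP ->]]].
  have [->|[a ->]] := cP g; first by have [] := span_submodule (components I).
  by apply: sub_span; exists r, a.
move=> _ [r [a [Ir ->]]]; apply: sub_span; exists r%:F => //; apply: sub_span.
by have [c [cP cE]] := loc_decomposition_exists r a; exists c, (qdiff a 0).
Qed.

Lemma components_hom I x : components I x -> exists a, grF gr a x.
Proof.
by move=> [r [a [_ ->]]]; exists a, (component gr r a) => //; apply: component_gr.
Qed.

Lemma sub_content I : I `<=` @base_ring R -> I `<=` content gr I.
Proof.
move=> IR x Ix; have [r _ xE] := IR _ Ix; rewrite contentE// -xE.
have [s [_ _ ->]] := component_support gr_grading r; rewrite raddf_sum.
apply: submodule_sum (span_submodule _) _ => a _ _; apply: sub_span.
by exists r, a; rewrite xE.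
Qed.

Lemma content_sub I A : I `<=` A -> is_hom_ideal gr A -> content gr I `<=` A.
Proof.
move=> IA /(hom_idealP gr_grading)[[sA AR] cA].
rewrite contentE; last exact: subset_trans AR.
by apply: span_sub => // _ [r [a [/IA Ar ->]]]; apply: cA.
Qed.
End Content.

(** * Homogeneous star operations of finite type *)

(** In the application [H] consists of the homogeneous elements, since a homogeneous star operation
    commutes only with homogeneous scalars. The list [G'] holds the elements of [G] not yet known to
    send [u] into [V]; it is emptied by induction on its length and on the exponent of its head. *)
Lemma saturated_nilpotent (R : comNzRingType) (V H : set R) (G : seq R) (v : R) :
  ideal_set V -> (forall u y, H u -> y \in G -> H (u * y)) ->
  (forall u, H u -> (forall y, y \in G -> V (u * y)) -> V u) ->
  H v -> (forall y, y \in G -> exists N, V (y ^+ N * v)) -> V v.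
Proof.
move=> [V0 VD VM] HG Vsat Hv Vv.
suff main (G' : seq R) u : H u ->
    (forall y, y \in G -> y \in G' \/ V (u * y)) ->
    (forall y, y \in G' -> y \in G /\ exists N, V (y ^+ N * u)) -> V u.
  by apply: (main G v Hv) => [y|y yG]; [left|split=> //; apply: Vv].
elim: G' u => [|x G' IH] u Hu uG uG'; first by apply: Vsat => // y /uG[].
have [xG [N]] := uG' _ (mem_head _ _).
elim: N u Hu uG uG' => [|N IHN] u Hu uG uG' Vxu; first by rewrite expr0 mul1r in Vxu.
(* Passing from [u] to [u * x] lowers the exponent needed for [x] by one; after that [x] can leave
   the list. *)
have Vux : V (u * x).
  apply: IHN; first exact: HG.
  - by move=> y /uG[]; [left|right; rewrite mulrAC mulrC; apply: VM].
  - move=> y /uG'[yG [k Vk]]; split=> //; exists k.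
    by rewrite mulrA mulrC; apply: VM.
  - by rewrite mulrCA -exprSr mulrC.
apply: IH => // [y /uG[|]|y yG']; [|by right|].
  by rewrite inE => /predU1P[->|]; [right|left].
by apply: uG'; rewrite inE yG' orbT.
Qed.

Lemma finite_type_mono (R : idomainType) (F : set (set {fraction R}))
    (star : set {fraction R} -> set {fraction R}) (A B : set {fraction R}) :
  A `<=` B -> finite_type F star A `<=` finite_type F star B.
Proof.
move=> AB x [C [FC fC CA] Cx]; exists C => //; split=> //.
exact: subset_trans AB.
Qed.

(** The zero module is not a fractional ideal, so generators of a nonzero element are added to those
    needed for [y]. *)
Lemma span_finite_nonzero (R : idomainType) (S : set {fraction R}) y :
  span S != [set 0] -> span S y -> exists s : seq {fraction R},
  [/\ [set` s] `<=` S, span [set` s] != [set 0] & span [set` s] y].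
Proof.
move=> S0 Sy; have [x Sx x0] := nonzero_elt (span_submodule S) S0.
have [s [sS sx]] := span_finite Sx; have [t [tS ty]] := span_finite Sy.
exists (s ++ t); split.
- by move=> w /=; rewrite mem_cat => /orP[/sS|/tS].
- apply: (elt_nonzero _ x0); move: x sx {Sx x0}; apply: span_mono => w /= ws.
  by rewrite mem_cat ws.
- move: y ty {Sy}; apply: span_mono => w /= wt.
  by rewrite mem_cat wt orbT.
Qed.

Section HomogeneousStar.
Variables (M : nmodType) (R : idomainType) (gr : M -> set R).
Hypotheses (canc : cancellative M) (gr_grading : is_grading gr).
Variable star : set {fraction R} -> set {fraction R}.
Hypothesis star_hom : hom_star gr star.
Implicit Types (A B I J S : set {fraction R}).

Local Notation HF := (hom_frac_ideals gr).
Local Notation star_f := (finite_type HF star).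

Let star_HF A : HF A -> HF (star A). Proof. by have [+ _] := star_hom; apply. Qed.
Let star_sub A : HF A -> A `<=` star A.
Proof. by have [_ [_ _ + _ _]] := star_hom; apply. Qed.
Let star_mono A B : HF A -> HF B -> A `<=` B -> star A `<=` star B.
Proof. by have [_ [_ _ _ + _]] := star_hom; apply. Qed.
Let star_idem A : HF A -> star (star A) = star A.
Proof. by have [_ [_ _ _ _ +]] := star_hom; apply. Qed.

Lemma hom_star_base_ring : star (@base_ring R) = @base_ring R.
Proof.
have -> : @base_ring R = principal 1.
  by apply/seteqP; split=> _ [r _ <-]; exists r; rewrite ?mulr1.
have [e [h [he h0]]] := homogeneous_nonzero gr_grading.
have [_ [+ _ _ _ _]] := star_hom; apply; last exact: oner_neq0.
exists (qdiff e e); right; exists e, e, h%:F, h%:F; split=> //.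
- by exists h.
- by exists h.
- by rewrite tofrac_eq0.
- by rewrite divff// tofrac_eq0.
Qed.

Lemma hom_ideal_base_ring : is_hom_ideal gr (@base_ring R).
Proof.
apply/hom_idealP => //; split; last by move=> r a _; exists (component gr r a).
by split=> //; apply: base_ring_submodule.
Qed.

(** Monotonicity keeps [star A] inside [star R], which is [R]. *)
Lemma hom_star_ideal A : is_hom_ideal gr A -> A != [set 0] ->
  is_hom_ideal gr (star A).
Proof.
move=> hA A0; have HA := hom_frac_ideal_ideal gr_grading canc hA A0.
apply: hom_ideal_hom_frac_ideal => //; first exact: star_HF.
have [[sA AR] _] := hA; rewrite -[X in _ `<=` X]hom_star_base_ring.
apply: star_mono => //; apply: hom_frac_ideal_ideal => //.
  exact: hom_ideal_base_ring.
exact: nonzero_subset AR A0.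
Qed.

Section Generators.
Variable S : set {fraction R}.
Hypothesis S_hom : forall x, S x -> exists a, grF gr a x.
Hypothesis S_nonzero : span S != [set 0].

Let HF_span (s : seq {fraction R}) : [set` s] `<=` S ->
  span [set` s] != [set 0] -> is_hom_ideal gr (span [set` s]) /\ HF (span [set` s]).
Proof.
move=> sS s0; have hs : is_hom_ideal gr (span [set` s]).
  by apply: hom_ideal_span => // x /sS/S_hom.
by split=> //; apply: hom_frac_ideal_ideal.
Qed.

(** A finitely generated submodule of [span S] lies in the span of finitely many elements of [S], so
    the union defining [star_f] may be restricted to these spans. *)
Lemma finite_star_spanP x : star_f (span S) x <-> exists s : seq {fraction R},
  [/\ [set` s] `<=` S, span [set` s] != [set 0] & star (span [set` s]) x].
Proof.
split=> [[B [HB fB BS] Bx]|[s [sS s0 sx]]]; last first.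
  exists (span [set` s]) => //; split; first by case: (HF_span sS s0).
    by apply/fin_genP; exists s.
  exact: span_mono.
have [s [sS Bs]] := fin_gen_sub_span fB BS; exists s.
have [[sB B0 _] _] := HB.
have s0 : span [set` s] != [set 0] by apply: nonzero_subset Bs B0.
split=> //; move: x Bx; apply: star_mono => //.
by case: (HF_span sS s0).
Qed.

(** The finite subfamilies of [S] are directed, so several witnesses can be merged into one. *)
Let star_cat (s t : seq {fraction R}) : [set` s] `<=` S ->
  [set` t] `<=` S -> span [set` s] != [set 0] -> span [set` t] != [set 0] ->
  [/\ [set` s ++ t] `<=` S, span [set` s ++ t] != [set 0],
      star (span [set` s]) `<=` star (span [set` s ++ t])
    & star (span [set` t]) `<=` star (span [set` s ++ t])].
Proof.
move=> sS tS s0 t0.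
have stS : [set` s ++ t] `<=` S by move=> w /=; rewrite mem_cat => /orP[/sS|/tS].
have s_st : span [set` s] `<=` span [set` s ++ t].
  by apply: span_mono => w /= ws; rewrite mem_cat ws.
have t_st : span [set` t] `<=` span [set` s ++ t].
  by apply: span_mono => w /= wt; rewrite mem_cat wt orbT.
have st0 : span [set` s ++ t] != [set 0].
  exact: nonzero_subset (span_submodule _) s_st s0.
have [[_ Hs] [_ Ht]] := (HF_span sS s0, HF_span tS t0).
have [_ Hst] := HF_span stS st0.
by split=> //; apply: star_mono.
Qed.

Lemma sub_finite_star : span S `<=` star_f (span S).
Proof.
move=> x /(span_finite_nonzero S_nonzero)[s [sS s0 sx]].
apply/finite_star_spanP; exists s; split=> //; apply: star_sub => //.
by case: (HF_span sS s0).
Qed.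

Lemma finite_star_hom_ideal : is_hom_ideal gr (star_f (span S)).
Proof.
have [S0 _ _] := span_submodule S.
have star_hs (s : seq {fraction R}) : [set` s] `<=` S -> span [set` s] != [set 0] ->
    is_hom_ideal gr (star (span [set` s])).
  by move=> sS s0; apply: hom_star_ideal => //; case: (HF_span sS s0).
apply/hom_idealP => //; split; first split.
- split; first exact: sub_finite_star.
    move=> x y /finite_star_spanP[s [sS s0 sx]] /finite_star_spanP[t [tS t0 ty]].
    have [stS st0 s_st t_st] := star_cat sS tS s0 t0.
    apply/finite_star_spanP; exists (s ++ t); split=> //.
    have [[[_ stD _] _] _] := star_hs _ stS st0.
    by apply: stD; [exact: s_st|exact: t_st].
  move=> r x /finite_star_spanP[s [sS s0 sx]].
  apply/finite_star_spanP; exists s; split=> //.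
  by have [[[_ _ sM] _] _] := star_hs _ sS s0; apply: sM.
- move=> x /finite_star_spanP[s [sS s0 sx]].
  by have [[_ sR] _] := star_hs _ sS s0; apply: sR.
move=> r a /finite_star_spanP[s [sS s0 sx]].
apply/finite_star_spanP; exists s; split=> //.
by have /hom_idealP[//|_] := star_hs _ sS s0; apply.
Qed.

Lemma finite_star_idem : star_f (star_f (span S)) `<=` star_f (span S).
Proof.
move=> x [B [HB /fin_genP[b bE] BS] Bx].
(* One finite [s] serves all the generators of [B]; idempotence of [star] then concludes. *)
suff [s [sS s0 bs]] : exists s : seq {fraction R},
    [/\ [set` s] `<=` S, span [set` s] != [set 0] &
        [set` b] `<=` star (span [set` s])].
  have [_ Hs] := HF_span sS s0.
  apply/finite_star_spanP; exists s; split=> //; rewrite -star_idem//.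
  move: x Bx; apply: star_mono => //; first exact: star_HF.
  by rewrite bE; apply: span_sub => //; case: (star_HF Hs) => -[].
have {BS} : [set` b] `<=` star_f (span S).
  by apply: subset_trans BS; rewrite bE; apply: sub_span.
elim: b {bE} => [_|y b IH yb].
  have [S0 _ _] := span_submodule S.
  by have [s [sS s0 _]] := span_finite_nonzero S_nonzero S0; exists s.
have [|s [sS s0 bs]] := IH.
  by move=> z /= zb; apply: yb; rewrite /= inE zb orbT.
have /finite_star_spanP[t [tS t0 ty]] := yb y (mem_head _ _).
have [stS st0 s_st t_st] := star_cat sS tS s0 t0.
exists (s ++ t); split=> // z /=; rewrite inE => /predU1P[->|/bs/s_st//].
exact: t_st.
Qed.

End Generators.
End HomogeneousStar.

(** * The extension of a homogeneous star operation *)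

Section Extension.
Variables (M : nmodType) (R : idomainType) (gr : M -> set R).
Hypotheses (canc : cancellative M) (gr_grading : is_grading gr).
Variable star : set {fraction R} -> set {fraction R}.
Hypothesis star_hom : hom_star gr star.
Implicit Types (A B I J : set {fraction R}).

Local Notation star_f := (finite_type (hom_frac_ideals gr) star).
Local Notation ext_f := (finite_type (@frac_ideals R) (extension gr star_f)).

Lemma extensionP A x : extension gr star_f A x <->
  forall z, z != 0 -> colon A z -> star_f (content gr (scale z A)) (z * x).
Proof.
split=> Ax z => [z0 Az|[z0 Az]].
  by have [y yA <-] := Ax z (conj z0 Az); rewrite mulrA divff// mul1r.
exists (z * x); first exact: Ax.
by rewrite mulrA mulVf// mul1r.
Qed.

Lemma content_nonzero I : I `<=` @base_ring R -> submodule I -> I != [set 0] ->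
  content gr I != [set 0].
Proof. by move=> IR sI; apply: nonzero_subset => //; apply: sub_content. Qed.

Lemma sub_finite_star_content I : I `<=` @base_ring R -> content gr I != [set 0] ->
  content gr I `<=` star_f (content gr I).
Proof.
move=> IR; rewrite contentE// => I0; apply: sub_finite_star => //.
exact: components_hom.
Qed.

Lemma finite_star_content_hom_ideal I : I `<=` @base_ring R ->
  content gr I != [set 0] -> is_hom_ideal gr (star_f (content gr I)).
Proof.
move=> IR; rewrite contentE// => I0; apply: finite_star_hom_ideal => //.
exact: components_hom.
Qed.

Lemma finite_star_content_idem I : I `<=` @base_ring R ->
  content gr I != [set 0] ->
  star_f (star_f (content gr I)) `<=` star_f (content gr I).
Proof.
move=> IR; rewrite contentE// => I0; apply: finite_star_idem => //.
exact: components_hom.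
Qed.

Lemma scale_nonzero z A : submodule A -> z != 0 -> A != [set 0] ->
  scale z A != [set 0].
Proof.
move=> sA z0 /(nonzero_elt sA)[x Ax x0].
by apply: (@elt_nonzero _ _ (z * x)); [exists x|rewrite mulf_neq0].
Qed.

Lemma sub_extension A : submodule A -> A != [set 0] -> A `<=` extension gr star_f A.
Proof.
move=> sA A0 x Ax; apply/extensionP => z z0 Az.
have zA0 : content gr (scale z A) != [set 0].
  by apply: content_nonzero => //; [exact: submodule_scale|exact: scale_nonzero].
apply: sub_finite_star_content => //; apply: sub_content => //.
by exists x.
Qed.

Lemma sub_finite_extension I : is_ideal I -> I != [set 0] -> I `<=` ext_f I.
Proof.
(* The nonzero [y] keeps the finitely generated submodule nonzero even when [x] is 0. *)
move=> [sI IR] I0 x Ix; have [y Iy y0] := nonzero_elt sI I0.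
have BI : span [set` [:: x; y]] `<=` I.
  by apply: span_sub => // z /=; rewrite !inE => /orP[]/eqP->.
have sB := span_submodule [set` [:: x; y]].
have B0 : span [set` [:: x; y]] != [set 0].
  by apply: (elt_nonzero _ y0); apply: sub_span; rewrite /= !inE eqxx orbT.
exists (span [set` [:: x; y]]).
  split=> //; last by apply/fin_genP; exists [:: x; y].
  by apply: frac_ideal_ideal => //; split=> //; apply: subset_trans IR.
by apply: sub_extension => //; apply: sub_span; rewrite /= inE eqxx.
Qed.

Lemma finite_extension_fixed I : is_hom_ideal gr I -> I != [set 0] ->
  star_f I = I -> ext_f I = I.
Proof.
move=> hI I0 starI; have [iI _] := hI; have [_ IR] := iI.
apply/seteqP; split; last exact: sub_finite_extension.
move=> x [B [_ _ BI] /extensionP/(_ 1)]; rewrite scale1 mul1r => Bx.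
rewrite -starI; apply: finite_type_mono (Bx (oner_neq0 _) _).
  exact: content_sub.
by rewrite /colon /= scale1; apply: subset_trans IR.
Qed.

Lemma quotient_hom_loc d v e h : gr d v -> gr e h -> h != 0 ->
  hom_loc_gr gr (qdiff d e) (v%:F / h%:F).
Proof.
move=> vd he h0; right; exists d, e, v%:F, h%:F; split=> //.
- by exists v.
- by exists h.
- by rewrite tofrac_eq0.
Qed.

(** Multiplying [1] in [(s)^star] by the homogeneous [q = v / h] puts [q] in [(q s)^star], while
    [q s] lies in [T], which is closed under [star_f]. *)
Lemma finite_star_saturated T (s : seq {fraction R}) d v e h :
  [set` s] `<=` (fun x => exists a, grF gr a x) -> span [set` s] != [set 0] ->
  star (span [set` s]) 1 -> star_f T `<=` T -> submodule T ->
  gr d v -> v != 0 -> gr e h -> h != 0 ->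
  (forall y, y \in s -> T (v%:F / h%:F * y)) -> T (v%:F / h%:F).
Proof.
move=> s_hom s0 s1 starT sT vd v0 he h0 Ts.
have hs : is_hom_ideal gr (span [set` s]) by apply: hom_ideal_span.
have Hs := hom_frac_ideal_ideal gr_grading canc hs s0.
apply: starT; exists (scale (v%:F / h%:F) (span [set` s])); first split.
- exact: (hom_frac_ideal_scale gr_grading canc vd v0 he h0).
- apply/fin_genP; exists [seq v%:F / h%:F * y | y <- s]; rewrite scale_span.
  congr span; apply/seteqP; split=> [_ [y ys <-]|_ /mapP[y ys ->]].
    exact: map_f.
  by exists y.
- by rewrite scale_span; apply: span_sub => // _ [y ys <-]; apply: Ts.
have [_ [_ starZ _ _ _]] := star_hom; rewrite starZ//.
- by exists 1; rewrite ?mulr1.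
- by exists (qdiff d e); apply: quotient_hom_loc.
- by rewrite mulf_neq0// ?invr_eq0 tofrac_eq0.
Qed.

(** * Properness of the closed content of an ideal meeting [H] *)

Hypothesis M_torsionless : torsionless M.

(* The homogeneous element [h] of [J] forces every [z] in [colon (span b)] to be a
   quotient [w / h] with [w] in [R], which reduces contents to components in [R]. *)
Lemma finite_extension_unit J : is_ideal J -> J `&` hom_elts gr !=set0 ->
  star_f (content gr J) 1 -> ext_f J 1.
Proof.
move=> [sJ JR] [h [Jh hh]]; have [e [h0 [he h00 hE]]] := hom_elts_base hh.
have J0 : J != [set 0] by apply: (elt_nonzero Jh); case: hh.
have CJ0 := content_nonzero JR sJ J0; rewrite contentE// in CJ0 *.
have comp_hom := @components_hom _ _ gr gr_grading J.
move=> /(finite_star_spanP canc gr_grading star_hom comp_hom)[s [sJc s0 s1]].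
(* For [y] in [s], [f y] records an element of [J] and the degree in which [y] is its component;
   [(0, 0)] is a default elsewhere. *)
have /choice[f fP] y : exists p : R * M, y \in s ->
    J p.1%:F /\ y = (component gr p.1 p.2)%:F.
  have [/sJc[r [a [Jr ->]]]|_] := boolP (y \in s); first by exists (r, a).
  by exists (0, 0).
pose b := h :: [seq (f y).1%:F | y <- s].
have bJ : span [set` b] `<=` J.
  apply: span_sub => // z /=; rewrite inE => /predU1P[->//|/mapP[y /fP[Jy _] ->]].
  exact: Jy.
have sB := span_submodule [set` b].
have bh : span [set` b] h by apply: sub_span; rewrite /= mem_head.
have B0 : span [set` b] != [set 0] by apply: (elt_nonzero bh); case: hh.
exists (span [set` b]).
  split=> //; last by apply/fin_genP; exists b.
  by apply: frac_ideal_ideal => //; split=> //; apply: subset_trans JR.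
apply/extensionP => z z0 Bz; rewrite mulr1.
set E := content gr _.
have E0 : E != [set 0].
  by apply: content_nonzero => //; [exact: submodule_scale|exact: scale_nonzero].
have subE := sub_finite_star_content Bz E0.
have hT := finite_star_content_hom_ideal Bz E0.
have idemT := finite_star_content_idem Bz E0.
rewrite -/E in subE hT idemT.
have [[sT TR] _] := hT; have [T0 TD TM] := sT.
have [w _ wE] : @base_ring R (z * h) by apply: Bz; exists h.
have hF0 : h0%:F != 0 :> {fraction R} by rewrite tofrac_eq0.
have zE : z = w%:F / h0%:F by rewrite wE hE mulfK.
(* [V] collects the numerators over [h0] of the elements of [star_f E]; as [z = w / h0], the goal
   becomes [V w]. *)
pose V : set R := [set r | star_f E (r%:F / h0%:F)].
have Vi : ideal_set V.
  split=> [|x y Vx Vy|r x Vx]; rewrite /V /=.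
  - by rewrite tofrac0 mul0r.
  - by rewrite tofracD mulrDl; apply: TD.
  - by rewrite tofracM -mulrA; apply: TM.
have [V0 VD VM] := Vi.
(* With [q = z * (f y).1] in [R], one has [(f y).1 * w = h0 * q]. Its components are thus 0 or [h0]
   times components of [q], and the latter lie in [E]. *)
have Vconv y d : y \in s -> V (component gr ((f y).1 * w) d).
  move=> ys; have Bfy : span [set` b] (f y).1%:F.
    by apply: sub_span; rewrite /= inE (map_f (fun y => (f y).1%:F) ys) orbT.
  have [q _ qE] : @base_ring R (z * (f y).1%:F) by apply: Bz; exists (f y).1%:F.
  have -> : (f y).1 * w = h0 * q.
    apply/eqP; rewrite -tofrac_eq !tofracM qE wE hE; apply/eqP.
    by rewrite mulrCA [RHS]mulrCA [h0%:F * _]mulrC.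
  have [->//|] := eqVneq (component gr (h0 * q) d) 0.
  move=> /(component_homM gr_grading he)[c ->].
  rewrite (component_homMD gr_grading _ _ canc he) /V /= tofracM mulrC mulKf//.
  apply: subE; rewrite /E contentE//; apply: sub_span; exists q, c; split=> //.
  by rewrite qE; exists (f y).1%:F.
have Vw c : V (component gr w c).
  pose G := [seq component gr (f y).1 (f y).2 | y <- s].
  apply: (@saturated_nilpotent _ V [set v | exists d, gr d v] G) => //.
  - move=> u _ [d ud] /mapP[y ys ->].
    exists (d + (f y).2); apply: gradingM => //; exact: component_gr.
  - move=> v [d vd] Vv; have [->//|v0] := eqVneq v 0.
    apply: (finite_star_saturated _ s0 s1 idemT sT vd v0 he h00).
      by move=> x /sJc/comp_hom.
    move=> y ys; have [_ yE] := fP y ys.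
    rewrite yE mulrAC -tofracM; apply: Vv; exact: map_f.
  - by exists c; apply: component_gr.
  move=> _ /mapP[y ys ->].
  have [S [uS rS rE]] := component_support gr_grading (f y).1.
  have [S' [uS' wS' w_E]] := component_support gr_grading w.
  (* Outside the support of [(f y).1] the generator is 0, and exponent 1 suffices; exponent 0 would
     not. *)
  have [yS|/rS->] := boolP ((f y).2 \in S); last first.
    by exists 1%N; rewrite expr1 mul0r.
  have [|N VN] := convolution_nilpotent (unique_sums_torsionless canc M_torsionless)
      Vi uS uS' _ yS (F := component gr (f y).1) (W := component gr w).
    by move=> d; rewrite -(component_mul gr_grading d rE w_E); apply: Vconv.
  exists N; have [/VN//|/wS'->] := boolP (c \in S').
  by rewrite mulr0.
rewrite zE -/(V w); have [S' [_ _ ->]] := component_support gr_grading w.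
by apply: (ideal_set_sum Vi) => c _ _; apply: Vw.
Qed.

(** If [T] were [R], then [finite_extension_unit] would put 1 in [ext_f J], which is [J]. *)
Lemma finite_star_content_proper J : is_ideal J -> J `&` hom_elts gr !=set0 ->
  ext_f J = J -> J != @base_ring R ->
  let T := star_f (content gr J) in
  [/\ is_hom_ideal gr T, T != [set 0], star_f T = T, T != @base_ring R & J `<=` T].
Proof.
move=> iJ Jh extJ JR T; have [sJ JB] := iJ.
have J0 : J != [set 0] by case: Jh => h [Jh [h0 _]]; apply: elt_nonzero Jh h0.
have CJ0 := content_nonzero JB sJ J0.
have JT : J `<=` T.
  by apply: subset_trans (sub_finite_star_content JB CJ0); apply: sub_content.
split=> //.
- exact: finite_star_content_hom_ideal.
- exact: nonzero_subset JT J0.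
- apply/seteqP; split; first exact: finite_star_content_idem.
  by apply: finite_type_mono; apply: sub_finite_star_content.
apply: contra_neq JR => TR; apply/seteqP; split=> // _ [r _ <-].
rewrite -[r%:F]mulr1; have [_ _] := sJ; apply; rewrite -extJ.
apply: finite_extension_unit => //; rewrite -/T TR.
by exists 1; rewrite ?tofrac1.
Qed.

(** A nonzero element has a nonzero component, which stays in the ideal by homogeneity. *)
Lemma hom_ideal_hom_elt I : is_hom_ideal gr I -> I != [set 0] ->
  I `&` hom_elts gr !=set0.
Proof.
move=> /(hom_idealP gr_grading)[[sI IR] cI] /(nonzero_elt sI)[x Ix x0].
have [r _ rE] := IR _ Ix; rewrite -rE in Ix x0.
apply: contrapT => nex; move/eqP: x0; apply.
have [s [_ _ ->]] := component_support gr_grading r.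
rewrite raddf_sum big1// => a _; apply: contrapT => /eqP ca0; apply: nex.
exists (component gr r a)%:F; split; first exact: cI.
by split=> //; exists a, (component gr r a) => //; apply: component_gr.
Qed.
End Extension.

(** * Comparison of the two kinds of maximal ideals *)

Theorem corollary2p8 (Gamma : nmodType)
  (Gamma_nonzero : exists a : Gamma, a != 0)
  (Gamma_canc : cancellative Gamma) (Gamma_torsionless : torsionless Gamma)
  (R : idomainType) (gr : Gamma -> set R) (gr_grading : is_grading gr)
  (star : set {fraction R} -> set {fraction R}) (star_hom : hom_star gr star) :
  let star_f := finite_type (hom_frac_ideals gr) star in
  hMax_star gr star_f =
  [set N | Max_star (finite_type (@frac_ideals R) (extension gr star_f)) N /\
           N `&` hom_elts gr !=set0].
Proof.
move=> star_f; have fixed := finite_extension_fixed Gamma_canc gr_grading star_hom.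
have proper := finite_star_content_proper Gamma_canc gr_grading star_hom
  Gamma_torsionless.
apply/seteqP; split=> N.
  move=> [[hN N0 starN NR] maxN]; have Nh := hom_ideal_hom_elt gr_grading hN N0.
  split=> //; split=> [|J [iJ J0 extJ JR] NJ].
    by split=> //; [case: hN|exact: fixed].
  (* [J] inherits a homogeneous element from [N], so its closed content is a proper homogeneous
     ideal above [N]. By maximality it equals [N], which squeezes [J]. *)
  have [|//|//|hT T0 starT TR JT] := proper J iJ.
    by have [h [hN' hh]] := Nh; exists h; split=> //; apply: NJ.
  apply/seteqP; split=> //.
  by rewrite -(maxN _ _ (subset_trans NJ JT)).
move=> [[[iN N0 extN NR] maxN] Nh].
have [hT T0 starT TR NT] := proper N iN Nh extN NR.
(* The closed content is itself fixed by the finite type extension, so maximality of [N] forces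
   equality; this makes [N] homogeneous. *)
have TN : star_f (content gr N) = N.
  by apply: maxN => //; split=> //; [case: hT|exact: fixed].
rewrite -/star_f TN in hT starT.
split=> // J [hJ J0 starJ JR] NJ; apply: maxN => //; split=> //.
  by case: hJ.
exact: fixed.
Qed.
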